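(* Let $\mathcal{H}$ be a finite-dimensional complex Hilbert space with two tensor product factorizations $\mathcal{H}=\mathcal{H}_A\otimes\mathcal{H}_B=\mathcal{H}_{A'}\otimes\mathcal{H}_{B'}$, let $U\subset\mathcal{H}$ be a non-zero linear subspace with orthogonal projection $P$, let $p\ge 1$ be real, and let $k,l$ be integers with $1\le k\le\min(\dim\mathcal{H}_A,\dim\mathcal{H}_B)$ and $1\le l\le\min(\dim\mathcal{H}_{A'},\dim\mathcal{H}_{B'})$. For $|\psi\rangle\in\mathcal{H}$ with Schmidt decompositions $$|\psi\rangle=\sum_i\lambda_i^\psi|\psi_A^i\rangle\otimes|\psi_B^i\rangle=\sum_j\mu_j^\psi|\psi_{A'}^j\rangle\otimes|\psi_{B'}^j\rangle$$ with respect to the two factorizations, put $$G(\psi)=\sum_{i=1}^k(\lambda_i^\psi)^p+\sum_{j=1}^l(\mu_j^\psi)^p .$$ Consider the iteration that replaces a unit vector $|\psi\rangle\in U$ by the normalized vector $|\phi\rangle\in U$ that is a positive multiple of $$P\left(\sum_{i=1}^k(\lambda_i^\psi)^{p-1}|\psi_A^i\rangle\otimes|\psi_B^i\rangle+\sum_{j=1}^l(\mu_j^\psi)^{p-1}|\psi_{A'}^j\rangle\otimes|\psi_{B'}^j\rangle\right).$$ Then, for any sequence $(|\psi_m\rangle)_{m\ge0}$ generated by this iteration from a unit vector $|\psi_0\rangle\in U$, the quantity $G(\psi_m)$ is increasing in $m$ (i.e. $G(\psi_m)\le G(\psi_{m+1})$ for all $m$) and converges.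
   Context: A Schmidt decomposition of a vector $|\psi\rangle$ with respect to a factorization $\mathcal{H}=\mathcal{H}_A\otimes\mathcal{H}_B$, with $n_s=\min(\dim\mathcal{H}_A,\dim\mathcal{H}_B)$, is an expression $|\psi\rangle=\sum_{i=1}^{n_s}\lambda_i^\psi|\psi_A^i\rangle\otimes|\psi_B^i\rangle$ with $\lambda_1^\psi\ge\dots\ge\lambda_{n_s}^\psi\ge 0$ (the Schmidt coefficients, uniquely determined by $|\psi\rangle$ and the factorization) and orthonormal families $|\psi_A^i\rangle\in\mathcal{H}_A$, $|\psi_B^i\rangle\in\mathcal{H}_B$ (in general not unique; any choice is allowed at each step of the iteration). The equalities $\mathcal{H}=\mathcal{H}_A\otimes\mathcal{H}_B=\mathcal{H}_{A'}\otimes\mathcal{H}_{B'}$ denote fixed unitary identifications. When $p=1$, the factors $(\lambda_i^\psi)^{p-1}$ and $(\mu_j^\psi)^{p-1}$ are read as $1$ (also when the coefficient is $0$). *)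

(* Defs.v *)
From HB Require Import structures.
From mathcomp Require Import all_boot all_order all_algebra.
From mathcomp Require Import complex.
From mathcomp Require Import all_classical all_reals all_analysis.

Set Implicit Arguments.
Unset Strict Implicit.
Unset Printing Implicit Defensive.

Import Order.TTheory GRing.Theory Num.Theory.
Import numFieldNormedType.Exports.

Local Open Scope classical_set_scope.
Local Open Scope ring_scope.
Local Open Scope complex_scope.

(* A finite-dimensional complex Hilbert space is a [vectType R[i]] with an
   inner product [{dot _ for Num.conj}] (linear in its first argument). *)

(* A unitary identification H = HA (x) HB, given by the simple tensors
   [t a b]: multiplicativity of the inner products says that the linear map
   HA (x) HB -> H induced by [t] is isometric, the second clause that it is
   onto. *)
Definition is_tensor_product (R : realType) (H HA HB : vectType R[i])
    (dot : {dot H for Num.conj}) (dotA : {dot HA for Num.conj})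
    (dotB : {dot HB for Num.conj}) (t : {bilinear HA -> HB -> H}) : Prop :=
  (forall a a' b b', dot (t a b) (t a' b') = dotA a a' * dotB b b') /\
  (forall v : H, exists (n : nat) (a : 'I_n -> HA) (b : 'I_n -> HB),
     v = \sum_i t (a i) (b i)).

Definition is_orthogonal_projection (R : realType) (H : vectType R[i])
    (dot : {dot H for Num.conj}) (U : {vspace H}) (P : 'End(H)) : Prop :=
  forall v : H, P v \in U /\ v - P v \in orthov dot U.

Notation schmidt_index HA HB := 'I_(minn (dim HA) (dim HB)).

Definition is_schmidt_decomposition (R : realType) (H HA HB : vectType R[i])
    (dotA : {dot HA for Num.conj}) (dotB : {dot HB for Num.conj})
    (t : {bilinear HA -> HB -> H}) (psi : H)
    (lambda : schmidt_index HA HB -> R)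
    (a : schmidt_index HA HB -> HA) (b : schmidt_index HA HB -> HB) : Prop :=
  [/\ forall i, 0 <= lambda i,
      forall i j : schmidt_index HA HB, (i <= j)%N -> lambda j <= lambda i,
      orthonormal dotA (codom a),
      orthonormal dotB (codom b) &
      psi = \sum_i (lambda i)%:C *: t (a i) (b i)].

(* Schmidt decompositions exist and their coefficients are unique, so the
   choice made by [get] is immaterial. *)
Definition schmidt_coef (R : realType) (H HA HB : vectType R[i])
    (dotA : {dot HA for Num.conj}) (dotB : {dot HB for Num.conj})
    (t : {bilinear HA -> HB -> H}) (psi : H) : schmidt_index HA HB -> R :=
  get [set lambda | exists a b,
         is_schmidt_decomposition dotA dotB t psi lambda a b].

Definition schmidt_power_sum (R : realType) (H HA HB : vectType R[i])
    (dotA : {dot HA for Num.conj}) (dotB : {dot HB for Num.conj})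
    (t : {bilinear HA -> HB -> H}) (p : R) (k : nat) (psi : H) : R :=
  \sum_(i < minn (dim HA) (dim HB) | (i < k)%N)
    schmidt_coef dotA dotB t psi i `^ p.

(* [powR] satisfies 0 `^ 0 = 1, the convention needed here for p = 1. *)
Definition schmidt_truncation (R : realType) (H HA HB : vectType R[i])
    (t : {bilinear HA -> HB -> H}) (p : R) (k : nat)
    (lambda : schmidt_index HA HB -> R)
    (a : schmidt_index HA HB -> HA) (b : schmidt_index HA HB -> HB) : H :=
  \sum_(i < minn (dim HA) (dim HB) | (i < k)%N)
    (lambda i `^ (p - 1))%:C *: t (a i) (b i).

Definition iteration_step (R : realType) (H HA HB HA' HB' : vectType R[i])
    (dot : {dot H for Num.conj})
    (dotA : {dot HA for Num.conj}) (dotB : {dot HB for Num.conj})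
    (dotA' : {dot HA' for Num.conj}) (dotB' : {dot HB' for Num.conj})
    (t : {bilinear HA -> HB -> H}) (t' : {bilinear HA' -> HB' -> H})
    (U : {vspace H}) (P : 'End(H)) (p : R) (k l : nat) (psi phi : H) : Prop :=
  exists lambda a b mu a' b',
    [/\ is_schmidt_decomposition dotA dotB t psi lambda a b,
        is_schmidt_decomposition dotA' dotB' t' psi mu a' b',
        phi \in U,
        dot phi phi = 1 &
        exists2 c : R, 0 < c &
          phi = c%:C *: P (schmidt_truncation t p k lambda a b +
                           schmidt_truncation t' p l mu a' b')].

(* Main.v *)
Require Import Defs.
From HB Require Import structures.
From mathcomp Require Import all_boot all_order all_algebra.
From mathcomp Require Import complex.
From mathcomp Require Import all_classical all_reals all_analysis.
From mathcomp Require Import ring lra.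

Set Implicit Arguments.
Unset Strict Implicit.
Unset Printing Implicit Defensive.

Import Order.TTheory GRing.Theory Num.Theory.
Import numFieldNormedType.Exports.

Local Open Scope classical_set_scope.
Local Open Scope ring_scope.
Local Open Scope complex_scope.

(* Let T be the vector projected by the iteration step, so that phi is a
   positive multiple of P T.  As phi is the unit vector of U with the largest
   overlap with T, Re <psi, T> <= Re <phi, T>, where <psi, T> = G(psi).
   Von Neumann's trace inequality and then Young's inequality give
     p Re <phi, T> <= p (sum lambda_i^(p-1) lambda_i^phi
                         + sum mu_j^(p-1) mu_j^phi)
                   <= (p - 1) G(psi) + G(phi),
   hence G(psi) <= G(phi); and G is bounded on unit vectors.  The trace
   inequality also yields the uniqueness of the Schmidt coefficients. *)

(** * Rearrangement for substochastic matrices *)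

(** Layer-cake decomposition: [e r] is the drop of [w] from [r] to [r + 1], and these drops
    telescope. *)
Lemma nonincreasing_layers (R : numDomainType) (n : nat) (w : 'I_n -> R) :
    (forall i, 0 <= w i) ->
    (forall i j : 'I_n, (i <= j)%N -> w j <= w i) ->
  exists2 e : 'I_n -> R, forall r, 0 <= e r &
    forall i, w i = \sum_r e r * (i <= r)%N%:R.
Proof.
(* Extending [w] by 0 past the end makes the last drop the last value of [w], nonnegative by
   [w0]. *)
move=> w0 wd; pose v m := if insub m is Some i then w i else 0.
have vE (i : 'I_n) : v i = w i by rewrite /v valK.
exists (fun r : 'I_n => v r - v r.+1) => [r|i].
  rewrite subr_ge0 vE /v; case: insubP => [j _ jE|_]; last exact: w0.
  by apply: wd; rewrite jE.
transitivity (\sum_(i <= r < n) (v r - v r.+1)).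
  transitivity (- \sum_(i <= r < n) (v r.+1 - v r)).
    rewrite telescope_sumr ?(ltnW (ltn_ord i))// opprB vE.
    by rewrite /v insubN ?ltnn// subr0.
  by rewrite -sumrN; apply: eq_bigr => r _; rewrite opprB.
rewrite -[RHS](big_mkord xpredT (fun r => (v r - v r.+1) * (i <= r)%N%:R)).
rewrite [RHS](big_cat_nat (n := i)) ?(ltnW (ltn_ord i))//=.
rewrite [X in _ = X + _]big_nat_cond [X in _ = X + _]big1 ?add0r; last first.
  by move=> r; rewrite andbT => /andP[_ ri]; rewrite leqNgt ri mulr0.
by rewrite big_nat [RHS]big_nat; apply: eq_bigr => r /andP[-> _]; rewrite mulr1.
Qed.

(* By [nonincreasing_layers] it is enough to treat indicators of initial
   segments, for which one bounds a corner of [M] by its shorter side. *)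
Lemma substochastic_rearrangement (R : realDomainType) (n : nat)
    (M : 'I_n -> 'I_n -> R) (w s : 'I_n -> R) :
    (forall i j, 0 <= M i j) ->
    (forall i, \sum_j M i j <= 1) -> (forall j, \sum_i M i j <= 1) ->
    (forall i, 0 <= w i) ->
    (forall i j : 'I_n, (i <= j)%N -> w j <= w i) ->
    (forall i, 0 <= s i) ->
    (forall i j : 'I_n, (i <= j)%N -> s j <= s i) ->
  \sum_i \sum_j w i * s j * M i j <= \sum_i w i * s i.
Proof.
move=> M0 Mr Mc w0 wd s0 sd.
have [e e0 we] := nonincreasing_layers w0 wd.
have [f f0 sf] := nonincreasing_layers s0 sd.
pose c (r q i j : 'I_n) : R := (i <= r)%N%:R * (j <= q)%N%:R.
have layers i j : w i * s j = \sum_r \sum_q e r * f q * c r q i j.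
  rewrite we sf mulr_suml; apply: eq_bigr => r _; rewrite mulr_sumr.
  by apply: eq_bigr => q _; rewrite mulrACA.
have -> : \sum_i \sum_j w i * s j * M i j =
    \sum_r \sum_q e r * f q * (\sum_i \sum_j c r q i j * M i j).
  under eq_bigr => i _ do under eq_bigr => j _ do
    (rewrite layers mulr_suml; under eq_bigr => r _ do rewrite mulr_suml).
  under eq_bigr => i _ do rewrite exchange_big.
  rewrite exchange_big; apply: eq_bigr => r _ /=.
  under eq_bigr => i _ do rewrite exchange_big.
  rewrite exchange_big; apply: eq_bigr => q _ /=.
  rewrite mulr_sumr; apply: eq_bigr => i _; rewrite mulr_sumr.
  by apply: eq_bigr => j _; rewrite [RHS]mulrA.
under [X in _ <= X]eq_bigr => i _ do rewrite layers.
rewrite [X in _ <= X]exchange_big; apply: ler_sum => r _ /=.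
rewrite [X in _ <= X]exchange_big; apply: ler_sum => q _ /=.
rewrite -mulr_sumr ler_wpM2l ?mulr_ge0//.
have cM i j : c r q i j * M i j <= M i j.
  by rewrite ler_piMl// /c -natrM lern1 mulnb leq_b1.
have [rq|/ltnW qr] := leqP r q; last rewrite exchange_big.
  apply: ler_sum => i _; rewrite /c.
  have [ir|_] := leqP i r; last by rewrite big1 => [|j _]; rewrite !mul0r.
  rewrite (leq_trans ir rq) mulr1; apply: le_trans (Mr i).
  by apply: ler_sum => j _; have := cM i j; rewrite /c ir.
apply: ler_sum => j _; rewrite /c.
have [jq|_] := leqP j q; last by rewrite big1 => [|i _]; rewrite mulr0 ?mul0r.
rewrite (leq_trans jq qr) mulr1; apply: le_trans (Mc j).
by apply: ler_sum => i _; have := cM i j; rewrite /c jq.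
Qed.

(** * Orthonormal families and Bessel's inequality *)

Definition orthonormal_family (C : numClosedFieldType) (V : lmodType C)
    (dot : {dot V for Num.conj}) (I : eqType) (a : I -> V) :=
  forall i j, dot (a i) (a j) = (i == j)%:R.

(** Orthonormality of a sequence excludes repetitions, so [a] is injective and the Kronecker delta
    can be taken on indices. *)
Lemma orthonormal_codom (C : numClosedFieldType) (V : lmodType C)
    (dot : {dot V for Num.conj}) (I : finType) (a : I -> V) :
  orthonormal dot (codom a) -> orthonormal_family dot a.
Proof.
case/orthonormalP => /injectiveP a_inj aE i j.
by rewrite aE ?codom_f// (inj_eq a_inj).
Qed.

Lemma dot_orthonormal_sum (C : numClosedFieldType) (V : lmodType C)
    (dot : {dot V for Num.conj}) (I : finType) (a : I -> V) (c d : I -> C) :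
  orthonormal_family dot a ->
  dot (\sum_i c i *: a i) (\sum_i d i *: a i) = \sum_i c i * (d i)^*.
Proof.
move=> aE; rewrite linear_sumlz /=; apply: eq_bigr => i _.
rewrite linear_sumr /= (bigD1 i)//= big1 ?addr0 => [|j ji].
  by rewrite linearZl_LR linearZr_LR /= aE eqxx mulr1.
by rewrite linearZl_LR linearZr_LR /= aE eq_sym (negPf ji) !mulr0.
Qed.

(** Pythagoras: [u], the projection of [v] on the span of the family, is orthogonal to [v - u], and
    its squared norm is the left-hand side. *)
Lemma bessel (C : numClosedFieldType) (V : lmodType C)
    (dot : {dot V for Num.conj}) (I : finType) (a : I -> V) (v : V) :
  orthonormal_family dot a -> \sum_i `|dot v (a i)| ^+ 2 <= dot v v.
Proof.
move=> aE; pose u := \sum_i dot v (a i) *: a i.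
have uu : dot u u = \sum_i `|dot v (a i)| ^+ 2.
  rewrite dot_orthonormal_sum//.
  by apply: eq_bigr => i _; rewrite normCK.
have vu : dot v u = dot u u.
  rewrite uu {1}/u linear_sumr; apply: eq_bigr => i _.
  by rewrite linearZr_LR /= normCK mulrC.
have vuu : dot (v - u) u = 0 by rewrite linearBl /= vu subrr.
have -> : dot v v = dot (v - u) (v - u) + dot u u by rewrite -hnormDd// subrK.
by rewrite uu lerDr dnorm_ge0.
Qed.

(** * Real estimates for complex numbers, and Young's inequality *)

(** The squared modulus, valued in [R] rather than [R[i]] so that it can enter real inequalities. *)
Definition sqnormc (R : rcfType) (z : R[i]) : R :=
  complex.Re z ^+ 2 + complex.Im z ^+ 2.

Lemma sqnormc_ge0 (R : rcfType) (z : R[i]) : 0 <= sqnormc z.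
Proof. by rewrite addr_ge0 ?sqr_ge0. Qed.

Lemma sqnormcJ (R : rcfType) (z : R[i]) : sqnormc (z^*)%R = sqnormc z.
Proof. by case: z => x y; rewrite /sqnormc /= sqrrN. Qed.

(** Expand the squared modulus of [z - w^*], which is nonnegative. *)
Lemma Re_mulc_le (R : rcfType) (z w : R[i]) :
  complex.Re (z * w) <= (sqnormc z + sqnormc w) / 2.
Proof.
case: z w => [x y] [u v]; rewrite /sqnormc /=.
have := sqr_ge0 (x - u); have := sqr_ge0 (y + v); nra.
Qed.

Lemma Re_realM (R : rcfType) (x : R) (z : R[i]) :
  complex.Re (x%:C * z) = x * complex.Re z.
Proof. by case: z => u v /=; rewrite mul0r subr0. Qed.

Lemma Re_sum (R : rcfType) (I : Type) (r : seq I) (P : pred I) (F : I -> R[i]) :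
  complex.Re (\sum_(i <- r | P i) F i) = \sum_(i <- r | P i) complex.Re (F i).
Proof. by apply: (big_morph (@complex.Re R)) => // -[? ?] [? ?]. Qed.

Lemma bessel_unit (R : rcfType) (V : lmodType R[i])
    (dot : {dot V for Num.conj}) (I : finType) (a : I -> V) (v : V) :
  orthonormal_family dot a -> dot v v = 1 ->
  \sum_i sqnormc (dot v (a i)) <= 1.
Proof.
move=> aE v1; rewrite -lecR rmorph_sum rmorph1 -v1.
apply: le_trans (bessel v aE); apply: ler_sum => i _.
by rewrite -add_Re2_Im2.
Qed.

Lemma young_powRB1 (R : realType) (p x y : R) : 1 <= p -> 0 <= x -> 0 <= y ->
  p * (y * x `^ (p - 1)) <= (p - 1) * x `^ p + y `^ p.
Proof.
rewrite le_eqVlt => /predU1P[<- x0 y0|p1 x0 y0].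
  by rewrite subrr mul0r add0r mul1r powRr0 mulr1 powRr1.
have p0 : 0 < p by rewrite (lt_trans ltr01).
have q0 : 0 < p - 1 by rewrite subr_gt0.
have := @conjugate_powR R y (x `^ (p - 1)) p (p / (p - 1)) y0 (powR_ge0 _ _) p0
  (divr_gt0 p0 q0).
rewrite -powRrM [(p - 1) * _]mulrC divfK ?gt_eqF// invf_div => /(_ _) H0.
have /H0 : p^-1 + (p - 1) / p = 1 by field; rewrite gt_eqF.
rewrite -(ler_pM2l p0) => /le_trans; apply.
by rewrite le_eqVlt; apply/orP; left; apply/eqP; field; rewrite gt_eqF.
Qed.

(** * Schmidt decompositions for one factorization *)

Section SchmidtFamilies.
Variables (R : realType) (H HA HB : vectType R[i]).
Variables (dot : {dot H for Num.conj}).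
Variables (dotA : {dot HA for Num.conj}) (dotB : {dot HB for Num.conj}).
Variables (t : {bilinear HA -> HB -> H}).
Hypothesis tE :
  forall a a' b b', dot (t a b) (t a' b') = dotA a a' * dotB b b'.

(* Bounding [Re (z w)] by [(|z|^2 + |w|^2) / 2] makes the overlaps of the two
   pairs of families a substochastic matrix, by Bessel's inequality. *)
Lemma von_neumann_trace_ineq (n : nat) (s w : 'I_n -> R)
    (a c : 'I_n -> HA) (b d : 'I_n -> HB) :
    orthonormal_family dotA a -> orthonormal_family dotB b ->
    orthonormal_family dotA c -> orthonormal_family dotB d ->
    (forall i, 0 <= s i) ->
    (forall i j : 'I_n, (i <= j)%N -> s j <= s i) ->
    (forall i, 0 <= w i) ->
    (forall i j : 'I_n, (i <= j)%N -> w j <= w i) ->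
  complex.Re (dot (\sum_i (s i)%:C *: t (a i) (b i))
                  (\sum_i (w i)%:C *: t (c i) (d i))) <= \sum_i s i * w i.
Proof.
move=> oa ob oc od s0 sd w0 wd.
pose M i j := (sqnormc (dotA (a i) (c j)) + sqnormc (dotB (b i) (d j))) / 2.
apply: (@le_trans _ _ (\sum_i \sum_j s i * w j * M i j)); last first.
  apply: substochastic_rearrangement => // [i j|i|j].
  - by apply: divr_ge0 => //; apply: addr_ge0; apply: sqnormc_ge0.
  - rewrite /M -mulr_suml big_split /= ler_pdivrMr// mul1r.
    have ai : dotA (a i) (a i) = 1 by rewrite oa eqxx.
    have bi : dotB (b i) (b i) = 1 by rewrite ob eqxx.
    by have := bessel_unit oc ai; have := bessel_unit od bi; lra.
  rewrite /M -mulr_suml big_split /= ler_pdivrMr// mul1r.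
  (* Conjugate symmetry turns the column sums into Bessel sums of [c j] and [d j] along [a] and
     [b]. *)
  under eq_bigr => i _ do rewrite hermC expr0 mul1r sqnormcJ.
  under [X in _ + X]eq_bigr => i _ do rewrite hermC expr0 mul1r sqnormcJ.
  have cj : dotA (c j) (c j) = 1 by rewrite oc eqxx.
  have dj : dotB (d j) (d j) = 1 by rewrite od eqxx.
  by have := bessel_unit oa cj; have := bessel_unit ob dj; lra.
rewrite linear_sumlz Re_sum; apply: ler_sum => i _ /=.
rewrite linear_sumr Re_sum; apply: ler_sum => j _ /=.
have wR : Num.conj (w j)%:C = (w j)%:C by exact: conjc_real.
rewrite linearZl_LR linearZr_LR /= wR !Re_realM mulrA.
by rewrite ler_wpM2l ?mulr_ge0// tE Re_mulc_le.
Qed.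

(** The equality case of the trace inequality: the tensors [t (a i) (b i)] are themselves
    orthonormal. *)
Lemma Re_dot_tensor_families (n : nat) (s w : 'I_n -> R)
    (a : 'I_n -> HA) (b : 'I_n -> HB) :
    orthonormal_family dotA a -> orthonormal_family dotB b ->
  complex.Re (dot (\sum_i (s i)%:C *: t (a i) (b i))
                  (\sum_i (w i)%:C *: t (a i) (b i))) = \sum_i s i * w i.
Proof.
move=> oa ob; rewrite dot_orthonormal_sum => [|i j]; last first.
  by rewrite tE oa ob -natrM mulnb andbb.
rewrite Re_sum; apply: eq_bigr => i _.
have -> : Num.conj (w i)%:C = (w i)%:C by exact: conjc_real.
by rewrite Re_realM.
Qed.

Local Notation schmidt := (is_schmidt_decomposition dotA dotB t).

(** The weights [w] are left free to serve both for indicators, in the uniqueness proof, and for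
    truncated powers, in the iteration. *)
Lemma schmidt_dot_le (psi phi : H) lambda a b mu c d
    (w : schmidt_index HA HB -> R) :
    schmidt psi lambda a b -> schmidt phi mu c d ->
    (forall i, 0 <= w i) ->
    (forall i j : schmidt_index HA HB, (i <= j)%N -> w j <= w i) ->
  complex.Re (dot phi (\sum_i (w i)%:C *: t (a i) (b i))) <= \sum_i mu i * w i.
Proof.
move=> [_ _ /orthonormal_codom oa /orthonormal_codom ob _].
move=> [mu0 mud /orthonormal_codom oc /orthonormal_codom od ->] w0 wd.
exact: von_neumann_trace_ineq.
Qed.

(* Ky Fan: the overlap with the truncation to the first [k] terms of either
   decomposition shows that both have the same partial sums. *)
Lemma schmidt_uniq (psi : H) lambda a b mu c d :
  schmidt psi lambda a b -> schmidt psi mu c d -> lambda = mu.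
Proof.
suff partial_le lam lam' a1 b1 a2 b2 (k : nat) :
    schmidt psi lam a1 b1 -> schmidt psi lam' a2 b2 ->
    \sum_i lam i * (i < k)%N%:R <= \sum_i lam' i * (i < k)%N%:R.
  move=> s1 s2; have partial_eq k :
      \sum_i lambda i * (i < k)%N%:R = \sum_i mu i * (i < k)%N%:R.
    by apply/eqP; rewrite eq_le (partial_le _ _ _ _ _ _ _ s1 s2)
      (partial_le _ _ _ _ _ _ _ s2 s1).
  (* Each value is a difference of consecutive partial sums, so equal partial sums force equal
     coefficients. *)
  have diffE (f : schmidt_index HA HB -> R) j : f j =
      \sum_i f i * (i < j.+1)%N%:R - \sum_i f i * (i < j)%N%:R.
    rewrite -sumrB (bigD1 j)//= ltnSn ltnn mulr1 mulr0 subr0.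
    rewrite big1 ?addr0// => i; rewrite -val_eqE /= -mulrBr ltnS => ij.
    by rewrite leq_eqVlt (negPf ij) subrr mulr0.
  by apply/funext => j; rewrite (diffE lambda) (diffE mu) !partial_eq.
move=> s1 s2; have [_ _ /orthonormal_codom oa /orthonormal_codom ob psiE] := s1.
rewrite -(Re_dot_tensor_families _ _ oa ob) -psiE.
apply: (schmidt_dot_le s1 s2) => // i j ij.
by rewrite ler_nat; case: ltnP => // jk; rewrite (leq_ltn_trans ij jk).
Qed.

(** The given decomposition makes the set under [get] nonempty, and uniqueness identifies the chosen
    element. *)
Lemma schmidt_coefE (psi : H) lambda a b :
  schmidt psi lambda a b -> schmidt_coef dotA dotB t psi = lambda.
Proof.
move=> s; have [|a' [b' s']] := @getPex _
    [set lambda | exists a b, schmidt psi lambda a b].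
  by exists lambda, a, b.
exact: schmidt_uniq s' s.
Qed.

Lemma schmidt_power_sumE (p : R) (k : nat) (psi : H) lambda a b :
  schmidt psi lambda a b ->
  schmidt_power_sum dotA dotB t p k psi =
  \sum_(i < minn (dim HA) (dim HB) | (i < k)%N) lambda i `^ p.
Proof. by move=> s; rewrite /schmidt_power_sum (schmidt_coefE s). Qed.

(** The cut-off acts after the power: at [p = 1] a coefficient replaced by 0 would still get weight
    1. *)
Definition truncated_weight (p : R) (k : nat)
    (lambda : schmidt_index HA HB -> R) (i : schmidt_index HA HB) : R :=
  if (i < k)%N then lambda i `^ (p - 1) else 0.

Lemma schmidt_truncationE (p : R) (k : nat) lambda a b :
  schmidt_truncation t p k lambda a b =
  \sum_i (truncated_weight p k lambda i)%:C *: t (a i) (b i).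
Proof.
rewrite /schmidt_truncation big_mkcond; apply: eq_bigr => i _.
by rewrite /truncated_weight; case: ifP => // _; rewrite scale0r.
Qed.

Lemma sum_truncated_weight (p : R) (k : nat) lambda
    (f : schmidt_index HA HB -> R) :
  \sum_i f i * truncated_weight p k lambda i =
  \sum_(i < minn (dim HA) (dim HB) | (i < k)%N) f i * lambda i `^ (p - 1).
Proof.
rewrite [RHS]big_mkcond; apply: eq_bigr => i _.
by rewrite /truncated_weight; case: ifP => // _; rewrite mulr0.
Qed.

Lemma Re_dot_truncation (p : R) (k : nat) (psi : H) lambda a b :
    1 <= p -> schmidt psi lambda a b ->
  complex.Re (dot psi (schmidt_truncation t p k lambda a b)) =
  schmidt_power_sum dotA dotB t p k psi.
Proof.
move=> p1 s; rewrite (schmidt_power_sumE _ _ s) schmidt_truncationE.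
have [l0 _ /orthonormal_codom oa /orthonormal_codom ob ->] := s.
rewrite Re_dot_tensor_families// sum_truncated_weight.
by apply: eq_bigr => i _; rewrite mulr_powRB1// (lt_le_trans ltr01).
Qed.

Lemma Re_dot_truncation_le (p : R) (k : nat) (psi phi : H) lambda a b mu c d :
    1 <= p -> schmidt psi lambda a b -> schmidt phi mu c d ->
  p * complex.Re (dot phi (schmidt_truncation t p k lambda a b)) <=
  (p - 1) * schmidt_power_sum dotA dotB t p k psi
    + schmidt_power_sum dotA dotB t p k phi.
Proof.
move=> p1 s s'; have p0 : 0 <= p := le_trans ler01 p1.
rewrite (schmidt_power_sumE _ _ s) (schmidt_power_sumE _ _ s').
have [l0 ld _ _ _] := s; have [mu0 _ _ _ _] := s'.
apply: (@le_trans _ _ (p * \sum_i mu i * truncated_weight p k lambda i)).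
  rewrite ler_wpM2l// schmidt_truncationE; apply: (schmidt_dot_le s s').
    by move=> i; rewrite /truncated_weight; case: ifP => // _; exact: powR_ge0.
  (* The weights are nonincreasing: powers with exponent [p - 1 >= 0] preserve order, and the 0 past
     the cut-off lies below them. *)
  move=> i j ij; rewrite /truncated_weight; case: ltnP => jk.
    by rewrite (leq_ltn_trans ij jk) ge0_ler_powR ?nnegrE ?subr_ge0// ld.
  by case: ifP => // _; exact: powR_ge0.
rewrite sum_truncated_weight !mulr_sumr -big_split; apply: ler_sum => i _.
exact: young_powRB1.
Qed.

(** The squared coefficients of a unit vector sum to 1, so every coefficient, and hence every power,
    is at most 1. *)
Lemma schmidt_power_sum_le (p : R) (k : nat) (psi : H) lambda a b :
    0 <= p -> dot psi psi = 1 -> schmidt psi lambda a b ->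
  schmidt_power_sum dotA dotB t p k psi <= (minn (dim HA) (dim HB))%:R.
Proof.
move=> p0 psi1 s; rewrite (schmidt_power_sumE _ _ s).
have [l0 _ /orthonormal_codom oa /orthonormal_codom ob psiE] := s.
have sq_sum : \sum_i lambda i * lambda i = 1.
  by rewrite -(Re_dot_tensor_families _ _ oa ob) -psiE psi1.
have le1 i : lambda i <= 1.
  rewrite -(@expr_le1 _ 2)// -sq_sum expr2 (bigD1 i)//= lerDl.
  by apply: sumr_ge0 => j _; apply: mulr_ge0.
rewrite -[X in _ <= X%:R]card_ord -sum1_card natr_sum.
rewrite big_mkcond; apply: ler_sum => i _; case: ifP => // _.
by have := ge0_ler_powR p0 _ _ (le1 i); rewrite powR1 !nnegrE; apply.
Qed.

End SchmidtFamilies.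

(** * Monotonicity and convergence of the iteration *)

Lemma Re_dot_unit_le1 (R : rcfType) (V : lmodType R[i])
    (dot : {dot V for Num.conj}) (u v : V) :
  dot u u = 1 -> dot v v = 1 -> complex.Re (dot u v) <= 1.
Proof.
move=> u1 v1; have := dnorm_ge0 dot (u - v); rewrite dnormB u1 v1.
case: (dot u v) => x y; rewrite lecE => /andP[_] /=.
lra.
Qed.

Lemma dot_orthogonal_projection (R : realType) (H : vectType R[i])
    (dot : {dot H for Num.conj}) (U : {vspace H}) (P : 'End(H)) (u v : H) :
  is_orthogonal_projection dot U P -> u \in U -> dot u (P v) = dot u v.
Proof.
move=> /(_ v)[_ /mem_orthovP vP] uU; apply/esym/eqP.
by rewrite -subr_eq0 -linearBr herm_eq0C vP.
Qed.

(** Decompositions of [phi] are assumed because the step itself only provides those of [psi]; along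
    the sequence the next step supplies them. *)
Lemma iteration_step_le (R : realType) (H HA HB HA' HB' : vectType R[i])
    (dot : {dot H for Num.conj})
    (dotA : {dot HA for Num.conj}) (dotB : {dot HB for Num.conj})
    (dotA' : {dot HA' for Num.conj}) (dotB' : {dot HB' for Num.conj})
    (t : {bilinear HA -> HB -> H}) (t' : {bilinear HA' -> HB' -> H})
    (U : {vspace H}) (P : 'End(H)) (p : R) (k l : nat) (psi phi : H)
    lambda a b mu a' b' :
    (forall a a' b b', dot (t a b) (t a' b') = dotA a a' * dotB b b') ->
    (forall a a' b b', dot (t' a b) (t' a' b') = dotA' a a' * dotB' b b') ->
    is_orthogonal_projection dot U P -> 1 <= p ->
    psi \in U -> dot psi psi = 1 ->
    is_schmidt_decomposition dotA dotB t phi lambda a b ->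
    is_schmidt_decomposition dotA' dotB' t' phi mu a' b' ->
    iteration_step dot dotA dotB dotA' dotB' t t' U P p k l psi phi ->
  schmidt_power_sum dotA dotB t p k psi + schmidt_power_sum dotA' dotB' t' p l psi
  <= schmidt_power_sum dotA dotB t p k phi
     + schmidt_power_sum dotA' dotB' t' p l phi.
Proof.
move=> tE tE' hP p1 psiU psi1 s s'.
move=> [l0 [a0 [b0 [mu0 [a0' [b0' [s0 s0' phiU phi1]]]]]]].
move=> [c c0 phiE]; set T := schmidt_truncation t _ _ _ _ _ in phiE.
set T' := schmidt_truncation t' _ _ _ _ _ in phiE.
have dot_phi u : u \in U ->
    complex.Re (dot u phi) = c * (complex.Re (dot u T) + complex.Re (dot u T')).
  move=> uU; have cR : Num.conj c%:C = c%:C by exact: conjc_real.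
  rewrite phiE linearZr_LR /= cR Re_realM (dot_orthogonal_projection _ hP)//.
  by rewrite linearDr raddfD.
(* After scaling by [c], the two sides are the real parts of [dot psi phi] and [dot phi phi = 1]. *)
have ge_c : complex.Re (dot psi T) + complex.Re (dot psi T')
    <= complex.Re (dot phi T) + complex.Re (dot phi T').
  by rewrite -(ler_pM2l c0) -!dot_phi// phi1 Re_dot_unit_le1.
move: ge_c; rewrite (Re_dot_truncation tE _ p1 s0) (Re_dot_truncation tE' _ p1 s0').
have := Re_dot_truncation_le tE k p1 s0 s.
have := Re_dot_truncation_le tE' l p1 s0' s'.
(* Multiply the overlap inequality by [p], add the two Young bounds, and cancel [p - 1] times the
   power sums of [psi]. *)
rewrite -/T -/T'; nra.
Qed.

Theorem corollary4p4 (R : realType) (H HA HB HA' HB' : vectType R[i])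
    (dot : {dot H for Num.conj})
    (dotA : {dot HA for Num.conj}) (dotB : {dot HB for Num.conj})
    (dotA' : {dot HA' for Num.conj}) (dotB' : {dot HB' for Num.conj})
    (t : {bilinear HA -> HB -> H}) (t' : {bilinear HA' -> HB' -> H})
    (ht : is_tensor_product dot dotA dotB t)
    (ht' : is_tensor_product dot dotA' dotB' t')
    (U : {vspace H}) (hU : U != 0%VS)
    (P : 'End(H)) (hP : is_orthogonal_projection dot U P)
    (p : R) (hp : 1 <= p) (k l : nat)
    (hk : (1 <= k <= minn (dim HA) (dim HB))%N)
    (hl : (1 <= l <= minn (dim HA') (dim HB'))%N)
    (psi : nat -> H) (psi0U : psi 0%N \in U) (psi0_unit : dot (psi 0%N) (psi 0%N) = 1)
    (hpsi : forall m, iteration_step dot dotA dotB dotA' dotB' t t' U P p k l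
                        (psi m) (psi m.+1)) :
  let G := fun v : H => schmidt_power_sum dotA dotB t p k v
                        + schmidt_power_sum dotA' dotB' t' p l v in
  (forall m, G (psi m) <= G (psi m.+1)) /\ cvgn (fun m => G (psi m)).
Proof.
move=> G; have [tE _] := ht; have [tE' _] := ht'.
have psiP m : psi m \in U /\ dot (psi m) (psi m) = 1.
  by case: m => // m; have [? [? [? [? [? [? [_ _ ? ? _]]]]]]] := hpsi m.
have incr m : G (psi m) <= G (psi m.+1).
  have [psiU psi1] := psiP m.
  have [? [? [? [? [? [? [s s' _ _ _]]]]]]] := hpsi m.+1.
  exact: iteration_step_le tE tE' hP hp psiU psi1 s s' (hpsi m).
split=> //; apply: nondecreasing_is_cvgn; first exact/nondecreasing_seqP.
(* Each power is at most 1, so the numbers of Schmidt coefficients bound [G]. *)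
exists ((minn (dim HA) (dim HB))%:R + (minn (dim HA') (dim HB'))%:R).
move=> _ [m _ <-]; have [_ psi1] := psiP m.
have [? [? [? [? [? [? [s s' _ _ _]]]]]]] := hpsi m.
have p0 : 0 <= p := le_trans ler01 hp.
by rewrite lerD// ?(schmidt_power_sum_le tE _ _ _ s)
  ?(schmidt_power_sum_le tE' _ _ _ s').
Qed.
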